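(* Let $1\le k\le n$. (i) Let $V(x,t)$, $x\in\mathbb{R}^k$, $t\ge 0$, be a smooth real-valued function and let $C=(c_{ij})\ge 0$ be a symmetric $k\times k$ matrix such that $V$ has the hill property with respect to $C$, and suppose that $$\forall T>0:\quad \liminf_{|x|\to\infty}\ \inf_{t\in[0,T]}V(x,t)\ge 0. \qquad ( * )$$ Then $V(x,0)\ge 0$ for all $x\in\mathbb{R}^k$ implies $V(x,t)\ge 0$ for all $x\in\mathbb{R}^k$ and $t\ge 0$. (ii) Let $\Omega\subset\mathbb{R}^n$ be a domain, $B:\Omega\to\mathbb{R}$ a smooth function, and let $A=(a_1,\dots,a_n)$ be a real $k\times n$ matrix of full rank $k$ with columns $a_j\in\mathbb{R}^k$. Let $C\ge 0$ be a symmetric $k\times k$ matrix such that $\langle Ca_j,a_j\rangle>0$ for all $j=1,\dots,n$, and suppose that $$P_{K(u)}\,\big(A^*CA\bullet\mathrm{Hess}\,B(u)\big)\,P_{K(u)}\le 0\qquad\text{for all }u\in\Omega,$$ where $K(u)=\ker (A\,D(u))$. Let $u_1,\dots,u_n:\mathbb{R}\to\mathbb{R}$ be smooth bounded functions with heat flows $u_j(y,t)$ (defined in the context) such that $(u_1(a_1\cdot x,t),\dots,u_n(a_n\cdot x,t))\in\Omega$ for all $x\in\mathbb{R}^k$, $t\ge 0$, and set $$V(x,t):=B\big(u_1(a_1\cdot x,t),\dots,u_n(a_n\cdot x,t)\big),\qquad x\in\mathbb{R}^k,\ t\ge 0.$$ Then $V$ has the hill property with respect to $C$. Moreover, if in addition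 $V$ satisfies $( * )$, then $V(x,0)\ge 0$ for all $x\in\mathbb{R}^k$ implies $V(x,t)\ge 0$ for all $x\in\mathbb{R}^k$ and $t\ge 0$. In particular, taking $x=0$ and $t=1/2$, one then has $$B\left(\int_{\mathbb{R}}u_1\big(y\sqrt{\langle Ca_1,a_1\rangle}\big)\,d\gamma_1(y),\dots,\int_{\mathbb{R}}u_n\big(y\sqrt{\langle Ca_n,a_n\rangle}\big)\,d\gamma_1(y)\right)\ge 0.$$
   Context: For a symmetric $k\times k$ matrix $C=(c_{ij})$ put $L_C=\sum_{i,j=1}^k c_{ij}\frac{\partial^2}{\partial x_i\partial x_j}$. A function $V(x,t)$ has the hill property with respect to $C$ if for every $(x_0,t_0)\in\mathbb{R}^k\times(0,\infty)$, $$\nabla_xV(x_0,t_0)=0\ \text{ and }\ \mathrm{Hess}_xV(x_0,t_0)\ge 0\ \Longrightarrow\ \Big(L_C-\frac{\partial}{\partial t}\Big)V(x_0,t_0)\le 0.$$ $\gamma_1$ is the standard Gaussian measure on $\mathbb{R}$. For the initial function $u_j$, the heat flow is $u_j(y,t)=\int_{\mathbb{R}}u_j\big(y+s\sqrt{2t\langle Ca_j,a_j\rangle}\big)\,d\gamma_1(s)$, $y\in\mathbb{R}$, $t\ge 0$; it solves $\frac{\partial}{\partial t}u_j(y,t)=\langle Ca_j,a_j\rangle\frac{\partial^2}{\partial y^2}u_j(y,t)$, $u_j(y,0)=u_j(y)$, and $x\mapsto u_j(a_j\cdot x,t)$ is the function denoted $(\mathcal{P}^C_tu_j(a_j\cdot))(x)$,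 i.e. the solution at time $t$ of $\partial_t w=L_Cw$ with initial data $u_j(a_j\cdot x)$. $D(u)$ is the $n\times n$ diagonal matrix with diagonal entries $\partial_1B(u),\dots,\partial_nB(u)$. $P_K$ denotes the orthogonal projection of $\mathbb{R}^n$ onto the subspace $K$. $M_1\bullet M_2$ is the entrywise (Schur) product, so $A^*CA\bullet\mathrm{Hess}\,B$ has entries $\langle Ca_i,a_j\rangle\partial_{ij}B$. $M\le0$ (resp. $M\ge0$) means negative (resp. positive) semidefinite. *)

(* Defs.v *)
From HB Require Import structures.
From mathcomp Require Import all_boot all_order all_algebra.
From mathcomp Require Import all_classical all_reals all_analysis.

Set Implicit Arguments.
Unset Strict Implicit.
Unset Printing Implicit Defensive.

Import Order.TTheory GRing.Theory Num.Theory.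
Import numFieldNormedType.Exports.

Local Open Scope classical_set_scope.
Local Open Scope ring_scope.

(* Points of R^m are row vectors 'rV[R]_m throughout. *)

Section LinearAlgebra.
Context {R : realType}.

Definition quad m (M : 'M[R]_m) (v : 'rV[R]_m) : R := (v *m M *m v^T) 0 0.

(* These constrain only the quadratic form; symmetry of M is not included. *)
Definition psd m (M : 'M[R]_m) : Prop := forall v, 0 <= quad M v.
Definition nsd m (M : 'M[R]_m) : Prop := forall v, quad M v <= 0.

(* The orthogonal projection onto the row space of U: the projection along
   kermx U^T, whose row space is the set of all v orthogonal to every row
   of U.  It is a symmetric matrix, so it is the same matrix whether it acts
   on rows or on columns. *)
Definition orthoproj p m (U : 'M[R]_(p, m)) : 'M[R]_m :=
  proj_mx <<U>>%MS (kermx U^T).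

(* kermx takes row vectors, w *m M = 0, hence the transpose. *)
Definition kerc p m (M : 'M[R]_(p, m)) : 'M[R]_m := kermx M^T.

Definition schur m (M N : 'M[R]_m) : 'M[R]_m := map2_mx *%R M N.

(* The j-th column a_j of A, as a point of R^k. *)
Definition acol k n (A : 'M[R]_(k, n)) (j : 'I_n) : 'rV[R]_k := (col j A)^T.

Definition dotv m (v w : 'rV[R]_m) : R := (v *m w^T) 0 0.

End LinearAlgebra.

Section Calculus.
Context {R : realType}.

(* C^infinity on an open set U of a finite-dimensional space: every iterated
   directional derivative of f is differentiable at every point of U. *)
Definition smooth (E : normedModType R) (U : set E) (f : E -> R) : Prop :=
  forall (s : seq E) (x : E), U x ->
    differentiable (foldr (fun v g => 'D_v g) f s) x.

(* C^infinity on an arbitrary set S (here a closed half-space): f locally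
   agrees on S with a function that is smooth on an open set. *)
Definition smooth_restr (E : normedModType R) (S : set E) (f : E -> R) : Prop :=
  forall x, S x -> exists (U : set E) (g : E -> R),
    [/\ open U, U x, smooth U g & forall y, (S `&` U) y -> f y = g y].

Definition partial m (i : 'I_m) (f : 'rV[R]_m -> R) : 'rV[R]_m -> R :=
  'D_(delta_mx 0 i) f.

Definition grad m (f : 'rV[R]_m -> R) (x : 'rV[R]_m) : 'rV[R]_m :=
  \row_i partial i f x.

Definition hess m (f : 'rV[R]_m -> R) (x : 'rV[R]_m) : 'M[R]_m :=
  \matrix_(i, j) partial i (partial j f) x.

Definition opL m (C : 'M[R]_m) (f : 'rV[R]_m -> R) (x : 'rV[R]_m) : R :=
  \sum_i \sum_j C i j * partial i (partial j f) x.

Definition domain m (U : set 'rV[R]_m) : Prop :=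
  [/\ U !=set0, open U & connected U].

(* A function on R^k x [0, oo) is represented by a total V : x -> t -> R; nothing
   below depends on its values at t < 0. *)
Definition smooth_spacetime k (V : 'rV[R]_k -> R -> R) : Prop :=
  smooth_restr [set p : 'rV[R]_k * R | 0 <= p.2] (fun p => V p.1 p.2).

Definition hill k (C : 'M[R]_k) (V : 'rV[R]_k -> R -> R) : Prop :=
  forall (x0 : 'rV[R]_k) (t0 : R), 0 < t0 ->
    grad (V ^~ t0) x0 = 0 -> psd (hess (V ^~ t0) x0) ->
    opL C (V ^~ t0) x0 - derive1 (V x0) t0 <= 0.

(* The filter |x| -> oo.  The library norm on 'rV[R]_k is the max norm; it
   defines the same filter as the Euclidean norm. *)
Definition at_infinity k : set_system 'rV[R]_k :=
  [set S | \forall M \near +oo, forall x : 'rV[R]_k, M < `|x| -> S x].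

(* The infimum and the liminf are taken in the extended reals. *)
Definition liminf_nonneg k (V : 'rV[R]_k -> R -> R) : Prop :=
  forall T : R, 0 < T ->
    (0 <= limf_einf
       (fun x => ereal_inf [set (V x t)%:E | t in `[0%R, T]])
       (@at_infinity k))%E.

(* The heat flow of f for d_t = c d_y^2; normal_prob 0 1 is the standard
   Gaussian measure. *)
Definition heat_flow (c : R) (f : R -> R) (y t : R) : R :=
  (\int[normal_prob 0 1]_(s in setT) f (y + s * Num.sqrt (2 * t * c)))%R.

End Calculus.

(* Main.v *)
Require Import Defs.
From HB Require Import structures.
From mathcomp Require Import all_boot all_order all_algebra.
From mathcomp Require Import all_classical all_reals all_analysis.
From mathcomp Require Import measurable_realfun.
From mathcomp Require Import ring lra.

(* (i) If V is negative at (x1, t1), then for a small eps > 0 the function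
   V + eps t is still negative there, and by the liminf condition it has a
   minimum over R^k x [0, t1], which lies at positive time.  At that point
   grad V = 0, Hess V >= 0 and d_t V <= - eps, while L_C V is the contraction of
   the two semidefinite matrices C and Hess V, hence nonnegative; this
   contradicts the hill property.

   (ii) Since every u_j solves its own heat equation, the second derivatives of
   the u_j cancel in (L_C - d_t) V, and what is left is the quadratic form of
   A^* C A o Hess B at the vector w = (u_j'(a_j x, t))_j.  The condition
   grad V = 0 says exactly that w lies in K(u).  For t > 0 the heat flow of a
   bounded function is differentiated on the Gaussian kernel; at t = 0 only its
   joint continuity is needed. *)

Set Implicit Arguments.
Unset Strict Implicit.
Unset Printing Implicit Defensive.

Import Order.TTheory GRing.Theory Num.Theory.
Import numFieldNormedType.Exports.

Local Open Scope classical_set_scope.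
Local Open Scope ring_scope.

(** * Gaussian kernels and the heat flow *)

Section GaussianKernel.
Context {R : realType}.
Notation mu := (@lebesgue_measure R).

(** For [k = 0] and [a = 1 / (4 c t)] this is the heat kernel up to normalisation. The power of
    [z - y] makes the linear span of the family closed under differentiation in [y] and in [a]. *)
Definition gker (k : nat) (y a z : R) : R :=
  (z - y) ^+ k * expR (- (a * (z - y) ^+ 2)).

(* [|w| ^ k <= exp (k |w|)], and [k |w|] is split by the AM-GM inequality. *)
Lemma exprn_le_gauss (k : nat) (b w : R) : 0 < b ->
  `|w| ^+ k <= expR (k%:R ^+ 2 / (2 * b)) * expR (b / 2 * w ^+ 2).
Proof.
move=> b0; apply: (@le_trans _ _ (expR (k%:R * `|w|))).
  rewrite expRM_natl lerXn2r ?nnegrE ?expR_ge0//.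
  by rewrite (le_trans _ (expR_ge1Dx _))// lerDr.
rewrite -expRD ler_expR -[w ^+ 2]real_normK ?num_real//.
set x := `|w|; set c : R := k%:R.
rewrite -subr_ge0.
have -> : c ^+ 2 / (2 * b) + b / 2 * x ^+ 2 - c * x =
    (c - b * x) ^+ 2 / (2 * b).
  by field; rewrite gt_eqF.
by rewrite divr_ge0 ?sqr_ge0// mulr_ge0// ltW.
Qed.

(* A bound uniform in [y] near [y0] and in [a >= b], to dominate the kernels
   when differentiating under the integral; it rests on
   [(z - y0) ^ 2 <= 2 (z - y) ^ 2 + 2]. *)
Lemma gker_bound (k : nat) (y y0 a b z : R) : 0 < b -> b <= a ->
  `|y - y0| <= 1 ->
  `|gker k y a z| <=
    expR (k%:R ^+ 2 / (2 * b) + b / 2) * expR (- (b / 4 * (z - y0) ^+ 2)).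
Proof.
move=> b0 ba yy0; rewrite /gker normrM normrX (ger0_norm (expR_ge0 _)).
set w := z - y.
apply: (@le_trans _ _ (expR (k%:R ^+ 2 / (2 * b)) * expR (b / 2 * w ^+ 2) *
                       expR (- (b * w ^+ 2)))).
  rewrite ler_pM ?exprn_ge0 ?expR_ge0 ?exprn_le_gauss//.
  by rewrite ler_expR lerN2 ler_wpM2r// sqr_ge0.
rewrite -!expRD ler_expR -!addrA lerD2l.
have h : (z - y0) ^+ 2 <= 2 * w ^+ 2 + 2.
  have -> : z - y0 = w + (y - y0) by rewrite /w addrA subrK.
  set d := y - y0 in yy0 *.
  have d1 : d ^+ 2 <= 1 by rewrite -[d ^+ 2]real_normK ?num_real// exprn_ile1.
  have := sqr_ge0 (w - d).
  nra.
have : b * (z - y0) ^+ 2 <= b * (2 * w ^+ 2 + 2) by rewrite ler_wpM2l// ltW.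
lra.
Qed.

Lemma measurable_gker k y a : measurable_fun setT (gker k y a).
Proof.
apply: measurable_funM; first by apply: measurable_funX; exact: measurable_funB.
apply: measurableT_comp => //; apply: measurableT_comp => //.
by apply: measurable_funM => //; apply: measurable_funX; exact: measurable_funB.
Qed.

(** The integrand is a constant multiple of the normal density with mean [y] and variance
    [1 / (2 c)]. *)
Lemma integrable_gauss (c y : R) : 0 < c ->
  mu.-integrable setT (fun z => (expR (- (c * (z - y) ^+ 2)))%:E).
Proof.
move=> c0; pose s := Num.sqrt (2 * c)^-1.
have s0 : s != 0 by rewrite gt_eqF// sqrtr_gt0 invr_gt0 mulr_gt0.
have s2 : s ^+ 2 = (2 * c)^-1 by rewrite sqr_sqrtr// invr_ge0 mulr_ge0// ltW.
have p0 := normal_peak_gt0 s0.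
have -> : (fun z => (expR (- (c * (z - y) ^+ 2)))%:E) =
  (fun z => ((normal_peak s)^-1)%:E * (normal_pdf y s z)%:E)%E.
  apply/funext => z.
  have -> : normal_pdf y s z = normal_peak s * normal_fun y s z.
    by rewrite normal_pdfE.
  rewrite -EFinM mulKf ?gt_eqF//.
  by congr (expR _)%:E; rewrite s2; field; rewrite gt_eqF.
by apply: integrableZl => //; exact: integrable_normal_pdf.
Qed.

Lemma integrable_gker_mul (u : R -> R) (M : R) k y a : measurable_fun setT u ->
  (forall z, `|u z| <= M) -> 0 < a ->
  mu.-integrable setT (fun z => (u z * gker k y a z)%:E).
Proof.
move=> mu_u uM a0.
have M0 : 0 <= M by apply: le_trans (uM 0).
apply: (@le_integrable _ _ _ mu setT _ _ (fun z =>
  ((M * expR (k%:R ^+ 2 / (2 * a) + a / 2))%:E *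
   (expR (- (a / 4 * (z - y) ^+ 2)))%:E)%E)) => //.
- by apply/measurable_EFinP/measurable_funM => //; exact: measurable_gker.
- move=> z _; rewrite -EFinM !abse_EFin lee_fin.
  apply: le_trans (ler_norm _); rewrite normrM -[leRHS]mulrA ler_pM//.
  by apply: gker_bound => //; rewrite subrr normr0.
- by apply: integrableZl => //; apply: integrable_gauss; rewrite divr_gt0.
Qed.

(** For [k = 0] the truncated index [k.-1] is harmless, since its coefficient vanishes. *)
Lemma is_derive_gker_y k (y a z : R) :
  is_derive y 1 (fun y => gker k y a z)
    (- k%:R * gker k.-1 y a z + 2 * a * gker k.+1 y a z).
Proof.
pose w : R -> R := cst z - id.
have -> : (fun y => gker k y a z) = (w ^+ k) * (expR \o (- (cst a * w ^+ 2))).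
  by apply/funext => y'; rewrite /gker /w !fctE.
apply: is_derive_eq.
rewrite !fctE /gker /GRing.scale/=.
have -> : w y = z - y by [].
rewrite (exprS _ k); ring.
Qed.

Lemma is_derive_gker_a k (y a z : R) :
  is_derive a 1 (fun a => gker k y a z) (- gker k.+2 y a z).
Proof.
have -> : (fun a => gker k y a z) =
    (cst ((z - y) ^+ k) * (expR \o (- (id * cst ((z - y) ^+ 2))))).
  by apply/funext => a'; rewrite /gker !fctE.
apply: is_derive_eq.
rewrite !fctE /gker /GRing.scale/= (exprS _ k.+1) (exprS _ k); ring.
Qed.

End GaussianKernel.

(** * Differentiation under the integral, the Gaussian density, affine substitution *)

Section Integrals.
Context {R : realType}.
Notation mu := (@lebesgue_measure R).

(** Existence and value of the derivative in one statement. Domination is asked for only within [r]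
    of [a], which is where [gker_bound] can provide it. *)
Lemma is_derive_under_integral (f df : R -> R -> R) (G : R -> R) (a r : R) :
  0 < r ->
  (forall x, `|x - a| < r -> mu.-integrable setT (EFin \o f x)) ->
  (forall x y : R, is_derive x 1 (f ^~ y) (df x y)) ->
  mu.-integrable setT (EFin \o G) ->
  (forall x y, `|x - a| < r -> `|df x y| <= G y) ->
  is_derive a 1 (fun x => \int[mu]_(y in setT) f x y)%R
    (\int[mu]_(y in setT) df a y)%R.
Proof.
move=> r0 intf derf intG Gub.
have itvP x : `]a - r, a + r[%classic x -> `|x - a| < r.
  by rewrite /= in_itv/= ltr_distl.
have Ia : `]a - r, a + r[%classic a.
  by rewrite /= in_itv/= ltrBlDr ltrDl r0.
have d1E x y : partial1of2 f x y = df x y.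
  by rewrite partial1of2E; apply: derive_val.
have G0 y : 0 <= G y by apply: le_trans (Gub a y _) => //; rewrite subrr normr0.
apply: DeriveDef.
  apply: (@derivable_under_integral R _ _ mu f setT measurableT a _ _ Ia
    _ _ G) => //.
  - by move=> x /itvP; exact: intf.
  - by move=> x y /itvP xr _; rewrite d1E; exact: Gub.
rewrite -derive1E.
rewrite (@differentiation_under_integral R _ _ mu f setT measurableT a _ _ Ia
  _ _ G) => //.
- by apply: eq_Rintegral => y _; exact: d1E.
- by move=> x /itvP; exact: intf.
- by move=> x y /itvP xr _; rewrite d1E; exact: Gub.
Qed.

(** The Radon-Nikodym derivative of the Gaussian measure agrees almost everywhere with [normal_pdf],
    because both have the same integral over every measurable set. Boundedness of [f] makes it
    integrable for a probability measure. *)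
Lemma Rintegral_normal_prob (f : R -> R) : measurable_fun setT f ->
  (exists K, forall z, `|f z| <= K) ->
  (\int[normal_prob 0 1]_(s in setT) f s)%R =
  (\int[mu]_(s in setT) (f s * normal_pdf 0 1 s))%R.
Proof.
move=> mf [K fK]; rewrite /Rintegral; congr fine.
have nf : (normal_prob 0 1).-integrable setT (EFin \o f).
  apply: (@le_integrable _ _ _ _ setT _ _ (fun=> K%:E)) => //.
  - exact/measurable_EFinP.
  - by move=> z _; rewrite /= lee_fin (le_trans (fK z))// ler_norm.
  - apply/integrableP; split=> //; rewrite integral_cst//=.
    by rewrite probability_setT mule1 ltry.
rewrite -(Radon_Nikodym_change_of_variables (normal_prob_dominates 0 1))//.
set rn := Radon_Nikodym _ _.
have rnE : ae_eq mu setT rn (fun z => (normal_pdf 0 1 z)%:E).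
  apply: integral_ae_eq => //.
  - by apply: Radon_Nikodym_integrable; exact: normal_prob_dominates.
  - by apply/measurable_EFinP; exact: measurable_normal_pdf.
  - move=> E _ mE.
    by rewrite -Radon_Nikodym_integral//; exact: normal_prob_dominates.
apply: ae_eq_integral => //.
- apply: emeasurable_funM; first exact/measurable_EFinP.
  by apply: measurable_int; apply: Radon_Nikodym_integrable;
    exact: normal_prob_dominates.
- apply/measurable_EFinP/measurable_funM => //; exact: measurable_normal_pdf.
- by apply: filterS rnE => z /(_ I) E _; rewrite /= E.
Qed.

Lemma integral_affine (g : R -> R) (y s : R) : 0 < s -> continuous g ->
  (forall z, 0 <= g z) ->
  (\int[mu]_z (g z)%:E = \int[mu]_z (s * g (y + z * s))%:E)%E.
Proof.
(* [F] is the map sending [x] to [y + x * s]; in this factored form its limits at both infinities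
   are those of a translation scaled by [s > 0]. *)
move=> s0 cg g0; pose F : R -> R := (id + cst (y / s)) * cst s.
have FE x : F x = y + x * s by rewrite /F !fctE mulrDl divfK ?gt_eqF// addrC.
have dF (x : R) : is_derive x 1 F s.
  by apply: is_derive_eq; rewrite /GRing.scale/= mulr0 add0r addr0 mulr1.
have F'E : F^`()%classic = cst s.
  by apply/funext => x; rewrite derive1E; apply: derive_val.
rewrite (@increasing_ge0_integration_by_substitutionT _ F)//.
- by rewrite F'E; apply: eq_integral => x _; rewrite !fctE FE mulrC.
- by move=> x x' xx'; rewrite !FE ltrD2l ltr_pM2r.
- by rewrite F'E => ?; exact: cvg_cst.
- by rewrite F'E; exact: is_cvg_cst.
- by rewrite F'E; exact: is_cvg_cst.
- by apply: gt0_cvgMlNy => //; exact: cvg_addrr_Ny.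
- by apply: gt0_cvgMly => //; exact: cvg_addrr.
Qed.

(** A signed [g] is the difference of [g + |g|] and [|g|], which are both nonnegative, continuous
    and integrable, so the nonnegative case applies to each. *)
Lemma Rintegral_affine (g : R -> R) (y s : R) : 0 < s -> continuous g ->
  mu.-integrable setT (EFin \o g) ->
  mu.-integrable setT (EFin \o (fun z => s * g (y + z * s))) /\
  (\int[mu]_(z in setT) g z = \int[mu]_(z in setT) (s * g (y + z * s)))%R.
Proof.
move=> s0 cg ig.
have caff (f : R -> R) : continuous f ->
    continuous (fun z : R => s * f (y + z * s)).
  move=> cf z; apply: cvgM; first exact: cvg_cst.
  apply: (cvg_comp (fun x : R => y + x * s) f _ (cf _)).
  by apply: cvgD; [exact: cvg_cst|apply: cvgM; [exact: cvg_id|exact: cvg_cst]].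
have pos (f : R -> R) : continuous f -> (forall z, 0 <= f z) ->
    mu.-integrable setT (EFin \o f) ->
    mu.-integrable setT (EFin \o (fun z => s * f (y + z * s))) /\
    (\int[mu]_(z in setT) f z = \int[mu]_(z in setT) (s * f (y + z * s)))%R.
  move=> cf f0 /integrableP[_ fi]; split; last first.
    by rewrite /Rintegral (integral_affine y s0).
  apply/integrableP; split.
    by apply/measurable_EFinP; apply: continuous_measurable_fun; exact: caff.
  have nE (h : R -> R) : (forall z, 0 <= h z) ->
      (\int[mu]_z `|(EFin \o h) z| = \int[mu]_z (h z)%:E)%E.
    by move=> h0; apply: eq_integral => z _; rewrite /= ger0_norm.
  rewrite nE// in fi; rewrite nE -?(integral_affine y s0)// => z.
  by rewrite mulr_ge0 ?(ltW s0).
have cn : continuous (fun z : R => `|g z|).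
  by move=> z; apply: cvg_norm; exact: cg.
have iN : mu.-integrable setT (EFin \o (fun z => `|g z|)).
  exact: integrable_norm.
have iD : mu.-integrable setT (EFin \o (fun z => g z + `|g z|)).
  exact: (integrableD measurableT ig iN).
have cD : continuous (fun z : R => g z + `|g z|).
  by move=> z; apply: cvgD; [exact: cg|exact: cn].
have D0 z : 0 <= g z + `|g z| by rewrite -lerBlDl sub0r -normrN ler_norm.
have [iN' EN] := pos _ cn (fun z => normr_ge0 _) iN.
have [iD' ED] := pos _ cD D0 iD.
have ig' : mu.-integrable setT (EFin \o (fun z => s * g (y + z * s))).
  apply: le_integrable iN' => //.
    by apply/measurable_EFinP; apply: continuous_measurable_fun; exact: caff.
  by move=> z _; rewrite /= lee_fin !normrM normr_id.
split=> //.
transitivity (\int[mu]_(z in setT) (g z + `|g z|) -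
              \int[mu]_(z in setT) `|g z|)%R.
  by rewrite -RintegralB//; apply: eq_Rintegral => z _; rewrite addrK.
rewrite EN ED -RintegralB//; apply: eq_Rintegral => z _.
by rewrite -mulrBr addrK.
Qed.

End Integrals.

(** * Integrals of a bounded continuous function against the Gaussian kernels *)

Section GaussianIntegral.
Context {R : realType}.
Notation mu := (@lebesgue_measure R).
Variables (u : R -> R) (M : R).
Hypothesis cu : continuous u.
Hypothesis uM : forall z, `|u z| <= M.

Let mu_u : measurable_fun setT u.
Proof. exact: continuous_measurable_fun. Qed.

Definition gint (k : nat) (y a : R) : R :=
  (\int[mu]_(z in setT) (u z * gker k y a z))%R.

Let M0 : 0 <= M. Proof. exact: le_trans (uM 0). Qed.

Lemma is_derive_gint_y (k : nat) (y a : R) : 0 < a ->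
  is_derive y 1 (fun y => gint k y a)
    (- k%:R * gint k.-1 y a + 2 * a * gint k.+1 y a).
Proof.
move=> a0.
(* [E j] is the constant of [gker_bound] for the power [j] with [b = a]; [D] adds up the bounds for
   the two kernels in the derivative. *)
pose E (j : nat) : R := expR (j%:R ^+ 2 / (2 * a) + a / 2).
pose D : R := M * (k%:R * E k.-1 + 2 * a * E k.+1).
pose G z := D * expR (- (a / 4 * (z - y) ^+ 2)).
pose df x z := u z * (- k%:R * gker k.-1 x a z + 2 * a * gker k.+1 x a z).
apply: (@is_derive_eq _ _ _ _ _ _ _ (\int[mu]_(z in setT) df y z)%R).
  apply: (@is_derive_under_integral _ (fun x z => u z * gker k x a z)
    df G y 1) => //.
  - by move=> x _; apply: integrable_gker_mul.
  - move=> x z; have := is_derive_gker_y k x a z => h.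
    exact: (is_deriveZ (u z) h).
  - have -> : EFin \o G = (fun z => D%:E *
       (expR (- (a / 4 * (z - y) ^+ 2)))%:E)%E by apply/funext => z.
    by apply: integrableZl => //; apply: integrable_gauss; rewrite divr_gt0.
  - move=> x z /ltW xy; rewrite /df /G /D normrM -[leRHS]mulrA ler_pM//.
    rewrite [leRHS]mulrDl (le_trans (ler_normD _ _))//; apply: lerD.
      rewrite normrM -[leRHS]mulrA normrN normr_nat ler_wpM2l//.
      exact: gker_bound.
    rewrite normrM -[leRHS]mulrA (ger0_norm (mulr_ge0 _ (ltW a0)))//.
    by apply: ler_wpM2l; [rewrite mulr_ge0 ?ltW|exact: gker_bound].
rewrite /df /gint.
have i j : mu.-integrable setT (fun z => (u z * gker j y a z)%:E).
  exact: integrable_gker_mul.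
have iZ c j : mu.-integrable setT (EFin \o (fun z => c * (u z * gker j y a z))).
  by rewrite /comp; under eq_fun do rewrite EFinM; exact: integrableZl.
under eq_Rintegral do rewrite mulrDr mulrCA (mulrCA (u _) (2 * a)).
rewrite RintegralD//.
by congr (_ + _); apply: (RintegralZl _ measurableT (i _)).
Qed.

Lemma is_derive_gint_a (k : nat) (y a : R) : 0 < a ->
  is_derive a 1 (fun a => gint k y a) (- gint k.+2 y a).
Proof.
(* Parameters within [a / 2] of [a] stay above [b], so a single Gaussian of rate [b / 4] dominates
   all of them. *)
move=> a0; pose b := a / 2.
have b0 : 0 < b by rewrite divr_gt0.
have ba x : `|x - a| < b -> b <= x.
  by rewrite /b ltr_distl => /andP[h _]; lra.
pose D := M * expR (k.+2%:R ^+ 2 / (2 * b) + b / 2).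
pose G z := D * expR (- (b / 4 * (z - y) ^+ 2)).
pose df x z := u z * - gker k.+2 y x z.
apply: (@is_derive_eq _ _ _ _ _ _ _ (\int[mu]_(z in setT) df a z)%R).
  apply: (@is_derive_under_integral _ (fun x z => u z * gker k y x z)
    df G a b) => //.
  - move=> x /ba bx; apply: integrable_gker_mul => //; exact: lt_le_trans bx.
  - move=> x z; have := is_derive_gker_a k y x z => h.
    exact: (is_deriveZ (u z) h).
  - have -> : EFin \o G = (fun z => D%:E *
       (expR (- (b / 4 * (z - y) ^+ 2)))%:E)%E by apply/funext => z.
    by apply: integrableZl => //; apply: integrable_gauss; rewrite divr_gt0.
  - move=> x z /ba bx; rewrite /df /G /D normrM -[leRHS]mulrA ler_pM// normrN.
    by apply: gker_bound => //; rewrite subrr normr0.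
rewrite /df /gint.
have i j : mu.-integrable setT (fun z => (u z * gker j y a z)%:E).
  exact: integrable_gker_mul.
under eq_Rintegral do rewrite mulrN -mulN1r.
by rewrite -[RHS]mulN1r; apply: (RintegralZl _ measurableT (i _)).
Qed.

(** This is the substitution [z = y + s * Num.sqrt (2 * t * c)]. The prefactor is the normalisation
    of the Gaussian divided by its standard deviation, expressed so that time enters only through
    [a = 1 / (4 c t)]. *)
Lemma heat_flow_gint (c y t : R) : 0 < c -> 0 < t ->
  heat_flow c u y t =
  normal_peak 1 * Num.sqrt (2 * (4 * c * t)^-1) * gint 0 y (4 * c * t)^-1.
Proof.
move=> c0 t0; rewrite /heat_flow; set s := Num.sqrt (2 * t * c).
set a := (4 * c * t)^-1.
have a0 : 0 < a by rewrite invr_gt0 !mulr_gt0.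
have s0 : 0 < s by rewrite sqrtr_gt0 !mulr_gt0.
have s2 : s ^+ 2 = 2 * t * c by rewrite sqr_sqrtr// !mulr_ge0// ltW.
have -> : Num.sqrt (2 * a) = s^-1.
  apply/eqP; rewrite -(@eqrXn2 _ 2) ?sqrtr_ge0 ?invr_ge0 ?ltW//.
  rewrite sqr_sqrtr ?mulr_ge0 ?ltW// exprVn s2 /a.
  by apply/eqP; field; rewrite !gt_eqF.
rewrite /gint Rintegral_normal_prob; last 2 first.
- apply: measurableT_comp; first exact: mu_u.
  by apply: measurable_funD => //; exact: measurable_funM.
- by exists M => z; exact: uM.
have cg : continuous (fun z : R => u z * gker 0 y a z).
  move=> z; apply: cvgM; first exact: cu.
  rewrite /gker; apply: cvgM; first by rewrite expr0; exact: cvg_cst.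
  apply: (cvg_comp _ expR); last exact: continuous_expR.
  apply: cvgN; apply: cvgM; first exact: cvg_cst.
  apply: (cvg_comp (fun x => x - y) (fun x => x ^+ 2)).
    by apply: cvgB => //; [exact: cvg_id|exact: cvg_cst].
  exact: sqr_continuous.
have [ig ->] := Rintegral_affine y s0 cg (integrable_gker_mul 0 y mu_u uM a0).
rewrite -(RintegralZl _ measurableT ig).
apply: eq_Rintegral => z _.
rewrite /gker normal_pdfE ?oner_neq0// /normal_fun subr0.
rewrite expr0 mul1r expr1n addrAC subrr add0r.
have -> : - z ^+ 2 / (1 *+ 2) = - (a * (z * s) ^+ 2) :> R.
  rewrite exprMn s2 /a mulr2n; field.
  by rewrite !gt_eqF.
by field; rewrite gt_eqF.
Qed.

End GaussianIntegral.

(** Reduces limits at a point to sequences, to which dominated convergence applies. If the limit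
    failed for some [e], choice would give points within [1 / (n + 1)] of [p] whose images stay at
    distance at least [e] from [l]. *)
Lemma seq_cvg (R : realType) (V : pseudoMetricType R) (f : V -> R)
    (p : V) (l : R) :
  (forall w : nat -> V, w n @[n --> \oo] --> p -> f (w n) @[n --> \oo] --> l) ->
  f x @[x --> p] --> l.
Proof.
move=> H; apply/cvgrPdist_lt => e e0; apply: contrapT => nH.
have /choice[w wP] : forall n : nat,
    exists x, ball p n.+1%:R^-1 x /\ e <= `|l - f x|.
  move=> n; apply: contrapT => nx; apply: nH.
  have r0 : 0 < n.+1%:R^-1 :> R by rewrite invr_gt0.
  apply: filterS (nbhsx_ballx p _ r0) => x px; rewrite ltNge.
  by apply/negP => ex; apply: nx; exists x.
have wp : w n @[n --> \oo] --> p.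
  apply/cvg_ballP => d d0; near=> n.
  have [+ _] := wP n; apply: le_ball; apply/ltW.
  by near: n; exact: near_infty_natSinv_lt (PosNum d0).
have /cvgrPdist_lt /(_ _ e0) := H w wp.
move=> [N _ /(_ N (leqnn N))]/=; rewrite ltNge.
by have [_ ->] := wP N.
Unshelve. all: by end_near. Qed.

(** * The heat flow of a bounded continuous function: continuity, derivatives, heat equation *)

Section HeatFlow.
Context {R : realType}.
Variables (u : R -> R) (c M : R).
Hypothesis cu : continuous u.
Hypothesis uM : forall z, `|u z| <= M.

(* Continuity holds on the whole plane since [Num.sqrt] is continuous and
   vanishes on negative reals: for [t <= 0] the heat flow is [u] itself. *)
Lemma continuous_heat_flow :
  continuous (fun p : R * R => heat_flow c u p.1 p.2).
Proof.
move=> p; apply: seq_cvg => w wp; rewrite /heat_flow /Rintegral.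
have mf (q : R * R) : measurable_fun setT
    (fun s : R => (u (q.1 + s * Num.sqrt (2 * q.2 * c)))%:E).
  apply/measurable_EFinP.
  apply: measurableT_comp; first exact: continuous_measurable_fun.
  by apply: measurable_funD => //; exact: measurable_funM.
have iM : (normal_prob 0 1).-integrable setT (fun _ : R => M%:E).
  apply/integrableP; split=> //; rewrite integral_cst//=.
  by rewrite probability_setT mule1 ltry.
have le q (x : R) : (`|(u (q.1 + x * Num.sqrt (2 * q.2 * c)))%:E| <= M%:E)%E.
  by rewrite /= lee_fin.
apply: fine_cvg; rewrite fineK; last first.
  apply: integrable_fin_num => //.
  apply: le_integrable iM => //; first exact: mf.
  by move=> x _; apply: le_trans (le p x) _; rewrite /= lee_fin ler_norm.
apply: (@dominated_cvg _ _ _ (normal_prob 0 1) setT _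
  (fun n s => (u ((w n).1 + s * Num.sqrt (2 * (w n).2 * c)))%:E) _
  (fun=> M%:E)) => //.
- by move=> n; exact: mf.
- move=> x _; apply: cvg_EFin; first exact: nearW.
  have w1 : (w n).1 @[n --> \oo] --> p.1.
    by apply: (cvg_comp w fst wp); exact: cvg_fst.
  have w2 : (w n).2 @[n --> \oo] --> p.2.
    by apply: (cvg_comp w snd wp); exact: cvg_snd.
  have wc : 2 * (w n).2 * c @[n --> \oo] --> 2 * p.2 * c.
    by apply: cvgM; [apply: cvgM => //; exact: cvg_cst|exact: cvg_cst].
  have ws := cvg_comp _ _ wc (@sqrt_continuous _ _).
  have wu : (w n).1 + x * Num.sqrt (2 * (w n).2 * c) @[n --> \oo] -->
      p.1 + x * Num.sqrt (2 * p.2 * c).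
    by apply: cvgD => //; apply: cvgM => //; exact: cvg_cst.
  have cux : {for p.1 + x * Num.sqrt (2 * p.2 * c), continuous u} by exact: cu.
  exact: (continuous_cvg _ cux wu).
Qed.

(* The first two [y]-derivatives of the heat flow, read off [heat_flow_gint]. *)
Definition heat_flow1 (y t : R) : R :=
  let a := (4 * c * t)^-1 in
  normal_peak 1 * Num.sqrt (2 * a) * (2 * a) * gint u 1 y a.

Definition heat_flow2 (y t : R) : R :=
  let a := (4 * c * t)^-1 in
  normal_peak 1 * Num.sqrt (2 * a) * (2 * a) *
    (2 * a * gint u 2 y a - gint u 0 y a).

Hypothesis c0 : 0 < c.

Let a_gt0 (t : R) : 0 < t -> 0 < (4 * c * t)^-1.
Proof. by move=> t0; rewrite invr_gt0 !mulr_gt0. Qed.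

Lemma is_derive_heat_flow1 (y t : R) : 0 < t ->
  is_derive y 1 (fun y => heat_flow c u y t) (heat_flow1 y t).
Proof.
move=> t0; have /(is_derive_gint_y cu uM 0 y) h := a_gt0 t0.
under eq_fun do rewrite (heat_flow_gint cu uM)//.
apply: (is_derive_eq
  (is_deriveZ (normal_peak 1 * Num.sqrt (2 * (4 * c * t)^-1)) h)).
rewrite /heat_flow1 /GRing.scale/=; ring.
Qed.

Lemma is_derive_heat_flow2 (y t : R) : 0 < t ->
  is_derive y 1 (fun y => heat_flow1 y t) (heat_flow2 y t).
Proof.
move=> t0; have /(is_derive_gint_y cu uM 1 y) h := a_gt0 t0.
apply: (is_derive_eq
  (is_deriveZ (normal_peak 1 * Num.sqrt (2 * (4 * c * t)^-1) *
               (2 * (4 * c * t)^-1)) h)).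
rewrite /heat_flow2 /GRing.scale/=; ring.
Qed.

(** Chain rule through the time change [a = 1 / (4 c t)]: [phi] is the flow as a function of [a],
    and [alpha] has derivative [- 4 c a ^ 2]. The formula of [heat_flow_gint] requires positive
    time, hence the equality with [phi \o alpha] is used only near [t]. *)
Lemma heat_equation (y t : R) : 0 < t ->
  is_derive t 1 (heat_flow c u y) (c * heat_flow2 y t).
Proof.
move=> t0; have a0 := a_gt0 t0; set a := (4 * c * t)^-1 in a0 *.
pose phi : R -> R :=
  cst (normal_peak 1) * (Num.sqrt \o (cst 2 * id)) * gint u 0 y.
pose alpha : R -> R := (fun x => x^-1) \o (cst (4 * c) * id).
have h2 : 0 < 2 * a by rewrite mulr_gt0.
have ds := is_derive1_sqrt h2.
have dg := is_derive_gint_a cu uM 0 y a0.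
have r0 : 0 < Num.sqrt (2 * a) by rewrite sqrtr_gt0.
have r2 : Num.sqrt (2 * a) ^+ 2 = 2 * a by rewrite sqr_sqrtr ?ltW.
have dphi : is_derive a 1 phi
    (normal_peak 1 * (gint u 0 y a * (Num.sqrt (2 * a))^-1 -
                      Num.sqrt (2 * a) * gint u 2 y a)).
  apply: is_derive_eq; rewrite /GRing.scale/= !fctE/=.
  by field; rewrite gt_eqF.
have dalpha : is_derive t 1 alpha (- (4 * c) * a ^+ 2).
  have t4 : (cst (4 * c) * id) t != 0 :> R by rewrite /= gt_eqF// !mulr_gt0.
  apply: DeriveDef; first exact: derivableV.
  rewrite deriveV// derive_val /GRing.scale/= !fctE /a.
  by field; rewrite !gt_eqF.
have dh : is_derive t 1 (phi \o alpha) (c * heat_flow2 y t).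
  apply: is_derive_eq; rewrite /heat_flow2 -/a.
  move: (Num.sqrt (2 * a)) (gint u 0 y a) (gint u 2 y a) r0 r2 => r g0 g2 r0 r2.
  (* Eliminating [a] in favour of the root [r] leaves an identity of rational functions. *)
  have -> : a = r ^+ 2 / 2 by rewrite r2 mulrC mulKf.
  by field; rewrite gt_eqF.
apply: near_eq_is_derive dh.
near=> x; rewrite (heat_flow_gint cu uM)//.
by near: x; exact: lt_nbhsr.
Unshelve. all: by end_near.
Qed.

End HeatFlow.

(** * Positive semidefinite matrices and orthogonal projections *)

Section PosSemiDef.
Context {R : realType}.
Variable m : nat.
Implicit Types (C H : 'M[R]_m) (v : 'rV[R]_m).

Lemma quadE C v : quad C v = \sum_i \sum_j C i j * (v 0 i * v 0 j).
Proof.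
rewrite /quad !mxE exchange_big/=; apply: eq_bigr => j _.
rewrite !mxE big_distrl/=; apply: eq_bigr => i _.
by rewrite mulrAC mulrC mulrA.
Qed.

Lemma quad_rank1 v w : quad (v^T *m v) w = (v *m w^T) 0 0 ^+ 2.
Proof.
rewrite /quad mulmxA -mulmxA mxE big_ord1 expr2; congr (_ * _).
by rewrite -[w *m v^T]trmxK trmx_mul trmxK mxE.
Qed.

(** Along a coordinate axis the form is a quadratic polynomial in the displacement; symmetry merges
    the two cross terms. The next three lemmas each pick a suitable displacement. *)
Lemma quad_addr C v (i : 'I_m) (a : R) : C^T = C ->
  quad C (v + a *: delta_mx 0 i) =
  quad C v + 2 * a * (row i C *m v^T) 0 0 + a ^+ 2 * C i i.
Proof.
move=> symC; rewrite /quad linearD/= linearZ/= trmx_delta.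
rewrite !mulmxDl !mulmxDr -!scalemxAl -!scalemxAr -rowE.
rewrite -[v *m C]trmxK trmx_mul symC.
have -> : (C *m v^T)^T *m delta_mx i 0 = row i C *m v^T :> 'M[R]_1.
  apply/matrixP => x y; rewrite !ord1 -colE !mxE; apply: eq_bigr => j _.
  by rewrite !mxE.
have -> : row i C *m delta_mx i 0 = (C i i)%:M :> 'M[R]_1.
  by apply/matrixP => x y; rewrite !ord1 -colE !mxE eqxx.
rewrite !mxE eqxx mulr1n; ring.
Qed.

Lemma psd_diag_ge0 C i : C^T = C -> psd C -> 0 <= C i i.
Proof.
move=> symC /(_ (0 + 1 *: delta_mx 0 i)); rewrite quad_addr// trmx0 mulmx0.
by rewrite /quad !mul0mx !mxE mulr0 !add0r expr1n mul1r.
Qed.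

(** Along the axis [i] the form is now affine, and an affine function that is nonnegative everywhere
    has slope zero. *)
Lemma psd_diag_eq0 C i : C^T = C -> psd C -> C i i = 0 -> row i C = 0.
Proof.
move=> symC pC Cii0.
have b0 v : (row i C *m v^T) 0 0 = 0.
  set b := _ 0 0; apply/eqP; apply: contraT => b0.
  (* This displacement would give the form the value [-1]. *)
  have := pC (v + (- (quad C v + 1) / (2 * b)) *: delta_mx 0 i).
  rewrite quad_addr// Cii0 mulr0 addr0 -/b.
  have -> : 2 * (- (quad C v + 1) / (2 * b)) * b = - (quad C v + 1).
    by field.
  by rewrite opprD addNKr oppr_ge0 ler10.
apply/rowP => j; have := b0 (delta_mx 0 j).
by rewrite trmx_delta -colE !mxE.
Qed.

(** The form of the Schur complement at [v] is the minimum of the form of [C] over the line through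
    [v] along the axis [i]. *)
Lemma psd_schur_complement C i : C^T = C -> psd C -> C i i != 0 ->
  psd (C - (C i i)^-1 *: ((row i C)^T *m row i C)).
Proof.
move=> symC pC Cii v.
have := pC (v + (- (row i C *m v^T) 0 0 / C i i) *: delta_mx 0 i).
rewrite quad_addr//; set b := (row i C *m v^T) 0 0.
suff -> : quad (C - (C i i)^-1 *: ((row i C)^T *m row i C)) v =
    quad C v - (C i i)^-1 * b ^+ 2.
  by move=> h; apply: le_trans h _; rewrite le_eqVlt; apply/orP; left;
     apply/eqP; field.
rewrite [LHS]/quad mulmxBr mulmxBl -scalemxAr -scalemxAl.
rewrite mxE [X in _ + X]mxE [X in _ - X]mxE.
by rewrite -/(quad _ v) -/(quad _ v) quad_rank1.
Qed.

(** Symmetric elimination, by induction on the number of nonzero diagonal entries. Subtracting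
    [w^T *m w] clears the entry [i], keeps the matrix semidefinite and revives no zero diagonal
    entry; once the diagonal vanishes, so does the matrix. *)
Lemma psd_sum_rank1 C : C^T = C -> psd C ->
  exists s : seq 'rV[R]_m, C = \sum_(v <- s) v^T *m v.
Proof.
have [N] := ubnP #|[pred i | C i i != 0]|.
elim: N C => // N IH C CN symC pC.
have [i Cii|C0] := pickP (fun i => C i i != 0); last first.
  exists [::]; rewrite big_nil; apply/row_matrixP => i.
  by rewrite row0 psd_diag_eq0//; have /negbFE/eqP := C0 i.
pose w : 'rV[R]_m := (Num.sqrt (C i i))^-1 *: row i C.
have Cii0 : 0 < C i i by rewrite lt_def Cii psd_diag_ge0.
have wE : w^T *m w = (C i i)^-1 *: ((row i C)^T *m row i C).
  rewrite /w -scalemxAr [(_ *: _)^T]linearZ/= -scalemxAl scalerA -invfM -expr2.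
  by rewrite sqr_sqrtr// ltW.
set C' := C - w^T *m w.
have symC' : C'^T = C' by rewrite /C' linearB/= trmx_mul trmxK symC.
have pC' : psd C' by rewrite /C' wE; exact: psd_schur_complement.
have C'E j : C' j j = C j j - (C i i)^-1 * C i j ^+ 2.
  by rewrite /C' wE !mxE big_ord1 !mxE expr2.
have sub : [pred j | C' j j != 0] \proper [pred j | C j j != 0].
  apply/properP; split.
    apply/fintype.subsetP => j; rewrite !inE; apply: contra => /eqP Cjj.
    have Cij : C i j = 0.
      rewrite -symC mxE; have /rowP/(_ i) := psd_diag_eq0 symC pC Cjj.
      by rewrite !mxE.
    by rewrite C'E Cij expr0n mulr0 subr0 Cjj.
  exists i; rewrite !inE//; apply/negPn/eqP.
  by rewrite C'E expr2 mulKf// subrr.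
have [|s sE] := IH C' _ symC' pC'.
  by rewrite -ltnS (leq_trans _ CN)// ltnS proper_card.
by exists (w :: s); rewrite big_cons -sE /C' addrC subrK.
Qed.

(** A decomposition of [C] into rank-one terms turns the contraction into a sum of values of the
    form of [H]. *)
Lemma psd_contract_ge0 C H : C^T = C -> psd C -> psd H ->
  0 <= \sum_i \sum_j C i j * H i j.
Proof.
move=> symC pC pH; have [s CE] := psd_sum_rank1 symC pC.
suff -> : \sum_i \sum_j C i j * H i j = \sum_(v <- s) quad H v.
  by apply: sumr_ge0 => v _; exact: pH.
under [RHS]eq_bigr do rewrite quadE.
rewrite [RHS]exchange_big/=; apply: eq_bigr => i _.
rewrite [RHS]exchange_big/=; apply: eq_bigr => j _.
rewrite CE summxE mulr_suml; apply: eq_bigr => v _.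
by rewrite !mxE big_ord1 !mxE mulrC.
Qed.

End PosSemiDef.

(** * The matrix of an orthogonal projection *)

Section OrthogonalProjection.
Context {R : realType}.
Variables (p m : nat) (U : 'M[R]_(p, m)).

Lemma dotv_eq0 (v : 'rV[R]_m) : v *m v^T = 0 -> v = 0.
Proof.
move=> /matrixP/(_ 0 0); rewrite !mxE => /eqP.
rewrite psumr_eq0; last by move=> i _; rewrite mxE -expr2 sqr_ge0.
move=> /allP h; apply/rowP => i; rewrite mxE.
by have := h i (mem_index_enum _); rewrite mxE -expr2 sqrf_eq0 => /eqP.
Qed.

(** A vector of the intersection is a combination of the rows of [U] and orthogonal to all of them,
    hence orthogonal to itself. *)
Lemma rowspace_capmx_orthogonal : (<<U>> :&: kermx U^T = 0)%MS.
Proof.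
apply/eqP; rewrite -submx0; apply/row_subP => i.
have := row_sub i (<<U>> :&: kermx U^T)%MS; set v := row i _.
rewrite sub_capmx genmxE => /andP[/submxP[z vE] /sub_kermxP vU].
by rewrite (@dotv_eq0 v) ?sub0mx// {2}vE trmx_mul mulmxA vU mul0mx.
Qed.

Lemma orthoproj_id (v : 'rV[R]_m) : (v <= U)%MS -> v *m orthoproj U = v.
Proof.
move=> vU; apply: proj_mx_id; last by rewrite genmxE.
exact: rowspace_capmx_orthogonal.
Qed.

(** The rows of [1 - P] are orthogonal to the row space of [U], which contains the rows of [P].
    Hence [(1 - P) P^T = 0], so [P^T = P P^T], and the right-hand side is symmetric. *)
Lemma orthoproj_sym : (orthoproj U)^T = orthoproj U.
Proof.
set P := orthoproj U.
have full : (1%:M <= <<U>> + kermx U^T)%MS.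
  rewrite sub1mx /row_full mxrank_disjoint_sum ?rowspace_capmx_orthogonal//.
  by rewrite genmxE mxrank_ker mxrank_tr subnKC ?rank_leq_col.
have PP : (1%:M - P) *m P^T = 0.
  have /sub_kermxP k : (1%:M - P <= kermx U^T)%MS.
    by rewrite -[P]mul1mx; exact: proj_mx_compl_sub.
  have /submxP[Z PZ] : (P <= U)%MS.
    by rewrite -[P]mul1mx -(genmxE U) proj_mx_sub.
  by rewrite {2}PZ trmx_mul mulmxA k mul0mx.
move: (P) PP => Q; rewrite mulmxBl mul1mx => /subr0_eq QQ.
by rewrite -[RHS]trmxK QQ trmx_mul trmxK.
Qed.

(** Converts the projected curvature condition into an inequality at the vectors of [K(u)]. *)
Lemma quad_orthoproj (M : 'M[R]_m) (v : 'rV[R]_m) : (v <= U)%MS ->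
  quad (orthoproj U *m M *m orthoproj U) v = quad M v.
Proof.
move=> /orthoproj_id; move: orthoproj_sym; move: (orthoproj U) => P symP vP.
by rewrite /quad !mulmxA vP -mulmxA -{1}symP -trmx_mul vP.
Qed.

End OrthogonalProjection.

(** * Directional derivatives and minima *)

Section Directional.
Context {R : realType}.

Lemma near_eq_differentiable (V W : normedModType R) (f g : V -> W) (x : V) :
  (\near x, f x = g x) -> differentiable f x -> differentiable g x.
Proof.
move=> fg /diff_locallyP[df fE].
have gE : g \o shift x = cst (g x) + 'd f x +o_ 0 id.
  apply/eqaddoP => e e0.
  have /eqaddoP /(_ e e0) := fE.
  have fgx : f x = g x by exact: nbhs_singleton fg.
  have : \forall h \near 0, f (h + x) = g (h + x).
    by move: fg; rewrite (near_shift 0)/= subr0.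
  by apply: filterS2 => h hfg; rewrite !fctE/= hfg fgx.
by apply/diff_locallyP; rewrite (diff_unique df gE).
Qed.

Lemma is_derive_line (V : normedModType R) (f : V -> R) (x v : V) (s d : R) :
  is_derive (s *: v + x) v f d -> is_derive s 1 (fun r => f (r *: v + x)) d.
Proof.
move=> [fd fE].
have E : (fun h : R => h^-1 *:
      (((fun r => f (r *: v + x)) \o shift s) (h *: 1) - f (s *: v + x))) =
    (fun h : R => h^-1 *:
      ((f \o shift (s *: v + x)) (h *: v) - f (s *: v + x))).
  by apply/funext => h/=; rewrite [h *: 1]mulr1 scalerDl addrA.
by apply: DeriveDef; rewrite /derivable/derive E.
Qed.

Lemma derive_partial m (f : 'rV[R]_m -> R) (x v : 'rV[R]_m) :
  differentiable f x -> 'D_v f x = \sum_i v 0 i * partial i f x.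
Proof.
move=> df; rewrite deriveE// {1}[v]row_sum_delta linear_sum.
by apply: eq_bigr => i _; rewrite linearZ /partial deriveE.
Qed.

(** If [d] were negative, [f'] would be negative just to the right of 0, and the mean value theorem
    would yield a value below [f 0]. *)
Lemma second_derivative_min (f f' : R -> R) (d : R) :
  (forall s : R, is_derive s 1 f (f' s)) -> is_derive (0 : R) 1 f' d ->
  (forall s, f 0 <= f s) -> f' 0 = 0 /\ 0 <= d.
Proof.
move=> df df' fmin.
have f'0 : f' 0 = 0.
  have d0 : is_derive (0 : R) 1 f 0.
    apply: (@derive1_at_min R f (-1) 1) => //.
    by rewrite in_itv/= ltrN10 ltr01.
  by have [_ <-] := df 0; have [_ ->] := d0.
split=> //; rewrite leNgt; apply/negP => d0.
have : \forall h \near 0^', h^-1 *: (f' (h *: 1 + 0) - f' 0) < 0.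
  have [+ dE] := df'; rewrite /derivable => /cvgr_lt; apply.
  by move: dE; rewrite /derive => ->.
rewrite f'0 => /nbhs_ballP[e /= e0 He].
have neg s : 0 < s -> s < e -> f' s < 0.
  move=> s0 se; have := He s; rewrite /ball/= sub0r normrN gtr0_norm// gt_eqF//.
  move=> /(_ se isT); rewrite subr0 addr0 [s *: 1]mulr1 /GRing.scale/=.
  by rewrite pmulr_rlt0// invr_gt0.
pose s := e / 2; have s0 : 0 < s by rewrite divr_gt0.
have [|c] := @MVT R f f' 0 s s0 (fun x _ => df x).
  apply: derivable_within_continuous => x _; exact: ex_derive.
rewrite in_itv/= => /andP[c0 cs] /eqP; rewrite subr0 subr_eq => /eqP fs.
have := fmin s; rewrite fs lerDr leNgt pmulr_llt0// neg//.
by rewrite (lt_trans cs)// ltr_pdivrMr// ltr_pMr// ltr1n.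
Qed.

(** The space-time minimum may sit at the final time, so only backward difference quotients can be
    compared and only a sign results. *)
Lemma derive_at_left_min (f : R -> R) (t d : R) : 0 < t -> is_derive t 1 f d ->
  (forall s, 0 <= s -> s <= t -> f t <= f s) -> d <= 0.
Proof.
move=> t0 df fmin; rewrite leNgt; apply/negP => d0.
have : \forall h \near 0^', 0 < h^-1 *: (f (h *: 1 + t) - f t).
  have [+ dE] := df; rewrite /derivable => /cvgr_gt; apply.
  by move: dE; rewrite /derive => ->.
move=> /nbhs_ballP[e /= e0 He].
(* The cap [e / 2] keeps [t - h] in the neighbourhood, the cap [t] keeps it nonnegative. *)
pose h := Num.min (e / 2) t.
have h0 : 0 < h by rewrite lt_min t0 divr_gt0.
have he : h < e.
  by rewrite gt_min ltr_pdivrMr// ltr_pMr// ltr1n.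
have := He (- h); rewrite /ball/= sub0r opprK gtr0_norm// oppr_eq0 gt_eqF//.
move=> /(_ he isT); rewrite [(- h) *: 1]mulr1 /GRing.scale/=.
rewrite invrN mulNr oppr_gt0 pmulr_rlt0 ?invr_gt0// subr_lt0 ltNge addrC fmin//.
  by rewrite subr_ge0 ge_min lexx orbT.
by rewrite gerBl ltW.
Qed.

(** Restriction to the line through [x0] in direction [v] reduces to one variable: ['D_v f] is a
    combination of the partial derivatives, and its own derivative along [v] is the Hessian form at
    [v]. *)
Lemma min_grad_hess m (f : 'rV[R]_m -> R) (x0 : 'rV[R]_m) :
  (forall x, differentiable f x) ->
  (forall j, differentiable (partial j f) x0) ->
  (forall x, f x0 <= f x) -> grad f x0 = 0 /\ psd (hess f x0).
Proof.
move=> df ddf fmin.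
have main v : 'D_v f x0 = 0 /\ 0 <= quad (hess f x0) v.
  pose f' s := 'D_v f (s *: v + x0).
  have D2 : is_derive x0 v ('D_v f) (quad (hess f x0) v).
    have -> : 'D_v f = \sum_j (v 0 j \*: partial j f).
      by apply/funext => x; rewrite derive_partial// fct_sumE.
    have h j : is_derive x0 v (v 0 j \*: partial j f)
       (v 0 j * \sum_i v 0 i * hess f x0 i j).
      have /diff_derivable dj := ddf j.
      apply: is_derive_eq; first by apply: is_deriveZ; exact/derivableP/dj.
      rewrite derive_partial//; congr (_ * _).
      by apply: eq_bigr => i _; rewrite mxE.
    apply: is_derive_eq.
    rewrite quadE exchange_big/=; apply: eq_bigr => j _.
    rewrite mulr_sumr; apply: eq_bigr => i _; ring.
  have [] := @second_derivative_min (fun s => f (s *: v + x0)) f'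
    (quad (hess f x0) v).
  - by move=> s; apply: is_derive_line; exact/derivableP/diff_derivable/df.
  - by apply: (@is_derive_line _ ('D_v f) x0 v 0); rewrite scale0r add0r.
  - by move=> s; rewrite scale0r add0r.
  - by rewrite /f' scale0r add0r.
split; last by move=> v; have [] := main v.
by apply/rowP => i; rewrite !mxE; have [] := main (delta_mx 0 i).
Qed.

End Directional.

(** * The maximum principle *)

Section MaximumPrinciple.
Context {R : realType}.

Lemma liminf_nonneg_lower_bound k (V : 'rV[R]_k -> R -> R) (T d : R) :
  liminf_nonneg V -> 0 < T -> 0 < d ->
  exists M, forall x t, M < `|x| -> 0 <= t -> t <= T -> - d < V x t.
Proof.
move=> lV T0 d0; have := lV T T0; rewrite limf_einfE => h.
have : ((- d)%:E < 0)%E by rewrite lte_fin oppr_lt0.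
move=> /lt_le_trans/(_ h)/ereal_sup_gt[_ [S [N [_ SN]] <-]] dS.
(* The filter gives [S] beyond every radius strictly larger than [N]; [N + 1] is one such radius. *)
exists (N + 1) => x t Mx t0 tT.
rewrite -lte_fin; apply: lt_le_trans dS _.
apply: ge_ereal_inf; exists (ereal_inf [set (V x t)%:E | t in `[0%R, T]]).
  by exists x => //; apply: (SN (N + 1)) => //; rewrite ltrDl.
apply: ge_ereal_inf; exists (V x t)%:E => //; exists t => //.
by rewrite /= in_itv/= t0.
Qed.

(** Regularity is split into continuity up to [t = 0] and differentiability for [t > 0], so that the
    statement covers both smooth functions and composites of heat flows. *)
Lemma max_principle k (V : 'rV[R]_k -> R -> R) (C : 'M[R]_k) :
  {within [set p : 'rV[R]_k * R | 0 <= p.2], continuous (fun p => V p.1 p.2)} ->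
  (forall x t, 0 < t -> differentiable (V ^~ t) x) ->
  (forall x t j, 0 < t -> differentiable (partial j (V ^~ t)) x) ->
  (forall x t, 0 < t -> derivable (V x) t 1) ->
  C^T = C -> psd C -> hill C V -> liminf_nonneg V ->
  (forall x, 0 <= V x 0) -> forall x t, 0 <= t -> 0 <= V x t.
Proof.
move=> cV dV ddV dtV symC pC hV lV V0 x1 t1 t1_ge0.
rewrite leNgt; apply/negP => Vneg.
have T0 : 0 < t1.
  by rewrite lt_def t1_ge0 andbT; apply: contraTneq Vneg => ->; rewrite -leNgt.
(* With this [eps] the perturbed function [W] takes the negative value [m / 2] at [(x1, t1)]. *)
pose m := V x1 t1; pose eps := - m / (2 * t1).
have eps0 : 0 < eps by rewrite divr_gt0 ?oppr_gt0 ?mulr_gt0.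
have m4 : 0 < - m / 4 by rewrite divr_gt0 ?oppr_gt0.
have [M VM] := liminf_nonneg_lower_bound lV T0 m4.
(* The radius is large enough for the lower bound [m / 4] on [V] outside the ball and for [K] to
   contain [(x1, t1)]. *)
pose N := Num.max M `|x1|.
pose K := [set x : 'rV[R]_k | `|x| <= N] `*` `[0, t1]%classic.
pose W (p : 'rV[R]_k * R) := V p.1 p.2 + eps * p.2.
have Kx1 : K (x1, t1).
  by split; rewrite /= ?in_itv/= ?lexx ?t1_ge0// le_max lexx orbT.
have cK : compact K.
  apply: compact_setX; last exact: segment_compact.
  apply: bounded_closed_compact.
    exists N; split; first exact: num_real.
    by move=> y Ny x /= /le_trans -> //; exact: ltW.
  have -> : [set x : 'rV[R]_k | `|x| <= N] =
    (fun x => `|x|) @^-1` [set r | r <= N] by [].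
  apply: preimage_closed; last exact: closed_le.
  by move=> x _; exact: norm_continuous.
have cW : {within K, continuous W}.
  have KS : K `<=` [set p : 'rV[R]_k * R | 0 <= p.2].
    by move=> [x t] [_ /=]; rewrite in_itv/= => /andP[].
  move=> p; apply: cvgD; first exact: (continuous_subspaceW KS cV).
  apply: cvgM; first exact: cvg_cst.
  have csnd : {within K, continuous (fun p : 'rV[R]_k * R => p.2)}.
    by apply: continuous_subspaceT => q; exact: cvg_snd.
  exact: csnd.
have [[x0 t0] + Wmin] := compact_EVT_min (ex_intro _ _ Kx1) cK cW.
rewrite inE => -[/= x0N]; rewrite in_itv/= => /andP[t0_ge0 t0t1].
have W1 : W (x1, t1) = m / 2.
  by rewrite /W /= -/m /eps; field; rewrite gt_eqF.
have W0 : W (x0, t0) <= m / 2 by rewrite -W1; apply: Wmin; rewrite inE.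
(* Outside the ball [W] exceeds [m / 4], hence [m / 2], so the minimum over [K] is a minimum over
   the whole strip. *)
have glob x t : 0 <= t -> t <= t1 -> W (x0, t0) <= W (x, t).
  move=> t_ge0 tt1; have [xN|xN] := leP `|x| N.
    by apply: Wmin; rewrite inE; split => //=; rewrite in_itv/= t_ge0.
  apply: (le_trans W0); rewrite /W/=.
  have := VM x t (le_lt_trans _ xN) t_ge0 tt1; rewrite le_max lexx => /(_ isT).
  have : 0 <= eps * t by rewrite mulr_ge0// ltW.
  move: Vneg; rewrite -/m; lra.
(* At time 0 the function [W] equals [V], which is nonnegative there, whereas the minimum is at most
   [m / 2 < 0]. *)
have t0_gt0 : 0 < t0.
  rewrite lt_def t0_ge0 andbT; apply/eqP => t00; move: W0.
  by rewrite /W t00/= mulr0 addr0 leNgt (lt_le_trans _ (V0 x0))// pmulr_llt0.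
have xmin x : V x0 t0 <= V x t0.
  by have := glob x t0 t0_ge0 t0t1; rewrite /W/= lerD2r.
have [g0 h0] := min_grad_hess (dV^~ t0 ^~ t0_gt0) (ddV x0 t0 ^~ t0_gt0) xmin.
have dt : is_derive t0 1 (fun t => V x0 t + eps * t) (derive1 (V x0) t0 + eps).
  have d1 := derivableP (dtV x0 t0 t0_gt0).
  have -> : (fun t => V x0 t + eps * t) = V x0 + cst eps * id by [].
  apply: is_derive_eq; rewrite derive1E /GRing.scale/=; ring.
have dle : derive1 (V x0) t0 + eps <= 0.
  apply: (derive_at_left_min t0_gt0 dt) => s s0 st.
  by apply: (glob x0 s) => //; exact: le_trans st t0t1.
have := hV x0 t0 t0_gt0 g0 h0.
have : 0 <= opL C (V^~ t0) x0.
  rewrite /opL; have := psd_contract_ge0 symC pC h0.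
  by under eq_bigr do under eq_bigr do rewrite mxE.
lra.
Qed.

Lemma smooth_spacetime_continuous k (V : 'rV[R]_k -> R -> R) :
  smooth_spacetime V ->
  {within [set p : 'rV[R]_k * R | 0 <= p.2], continuous (fun p => V p.1 p.2)}.
Proof.
move=> sV; apply/subspace_continuousP => p p0.
have [U [g [oU Up sg gE]]] := sV p p0.
have cg : {for p, continuous g}.
  exact/differentiable_continuous/(sg [::] p Up).
move: cg; rewrite /prop_for /continuous_at -(gE p (conj p0 Up)) => cg.
have cgw : g x @[x --> within [set q | 0 <= q.2] (nbhs p)] --> V p.1 p.2.
  exact: cvg_within_filter.
apply: cvg_trans cgw.
apply: near_eq_cvg; rewrite near_withinE.
have : \forall x \near p, U x by exact: open_nbhs_nbhs.
by apply: filterS => x Ux x0; apply/esym/gE.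
Qed.

(** * Regularity of the space and time slices of a smooth function at positive time *)

Section Slices.
Variables (k : nat) (V : 'rV[R]_k -> R -> R) (x0 : 'rV[R]_k) (t0 : R).
Hypotheses (sV : smooth_spacetime V) (t0_gt0 : 0 < t0).

(** Intersecting with the open half-space [t > 0] makes [V] agree with the smooth extension on a
    full neighbourhood. *)
Let slice_near : exists U g, [/\ open U, U (x0, t0), smooth U g &
  (forall y, U y -> V y.1 y.2 = g y)].
Proof.
have [U [g [oU Ux sg gE]]] := sV (ltW t0_gt0 : [set p | 0 <= p.2] (x0, t0)).
exists (U `&` [set p | 0 < p.2]), g; split => //.
- apply: openI => //.
  have -> : [set p : 'rV[R]_k * R | 0 < p.2] = snd @^-1` [set r | 0 < r] by [].
  by apply: open_comp; [move=> x _; exact: cvg_snd|exact: open_gt].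
- by move=> s x [Ux' _]; exact: sg.
- by move=> y [Uy /= y0]; apply: gE; split=> //=; exact: ltW.
Qed.

Lemma slice_derivable_time : derivable (V x0) t0 1.
Proof.
have [U [g [oU Ux sg gE]]] := slice_near.
have dg : differentiable g (x0, t0) by exact: (sg [::]).
have dp : differentiable (fun t : R => (x0, t)) t0.
  exact: differentiable_pair.
apply: (@near_eq_derivable _ _ _ (g \o (fun t => (x0, t)))).
  have cp : {for t0, continuous (fun t : R => (x0, t))}.
    exact: differentiable_continuous.
  have : \forall t \near t0, U (x0, t).
    exact: cp (open_nbhs_nbhs (conj oU Ux)).
  by apply: filterS => t Ut /=; rewrite -gE.
by apply/derivable1_diffP; exact: differentiable_comp.
Qed.

(** The agreement is recorded around each point near [x0], and not at [x0] alone, so that the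
    partial derivatives of both functions also agree near [x0]. *)
Lemma slice_near_space : exists U g, [/\ open U, U (x0, t0), smooth U g &
  \forall x \near x0, U (x, t0) /\ (\forall y \near x, g (y, t0) = V y t0)].
Proof.
have [U [g [oU Ux sg gE]]] := slice_near.
exists U, g; split=> //.
have cp x : {for x, continuous (fun x : 'rV[R]_k => (x, t0))}.
  by apply: differentiable_continuous; apply: differentiable_pair.
have : \forall x \near x0, U (x, t0).
  exact: cp (open_nbhs_nbhs (conj oU Ux)).
apply: filterS => x Uxt; split => //.
have : \forall y \near x, U (y, t0).
  exact: cp (open_nbhs_nbhs (conj oU Uxt)).
by apply: filterS => y /gE /= ->.
Qed.

Lemma slice_differentiable : differentiable (V ^~ t0) x0.
Proof.
have [U [g [oU Ux sg /nbhs_singleton[_ gE]]]] := slice_near_space.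
apply: (near_eq_differentiable gE).
have -> : (fun y => g (y, t0)) = g \o (fun x : 'rV[R]_k => (x, t0)) by [].
by apply: differentiable_comp; [apply: differentiable_pair|exact: (sg [::])].
Qed.

Lemma slice_partial_differentiable j : differentiable (partial j (V ^~ t0)) x0.
Proof.
have [U [g [oU Ux sg gE]]] := slice_near_space.
(* The partial derivative of the slice is the slice of a purely spatial directional derivative of
   [g]. *)
pose g' := 'D_(delta_mx 0 j, 0) g.
have dg' : differentiable (fun y => g' (y, t0)) x0.
  have -> : (fun y => g' (y, t0)) = g' \o (fun x : 'rV[R]_k => (x, t0)) by [].
  apply: differentiable_comp; first exact: differentiable_pair.
  exact: (sg [:: (delta_mx 0 j, 0)]).
apply: near_eq_differentiable dg'.
move: gE; apply: filterS => x [Uxt gx].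
rewrite /partial -(near_eq_derive _ gx) /g' /derive.
have -> // : (fun h : R => h^-1 *:
      ((g \o shift (x, t0)) (h *: (delta_mx 0 j, 0)) - g (x, t0))) =
    (fun h : R => h^-1 *:
      (((fun y => g (y, t0)) \o shift x) (h *: delta_mx 0 j) - g (x, t0))).
apply/funext => h /=; congr (_ *: (g _ - _)).
by congr (_, _); rewrite /= scaler0 add0r.
Qed.

End Slices.

End MaximumPrinciple.

(** * Functions of a row of heat flows *)

Section Rows.
Context {R : realType}.

Lemma differentiable_row (V : normedModType R) n (w : V -> 'rV[R]_n) (x : V) :
  (forall j, differentiable (fun x => w x 0 j) x) -> differentiable w x.
Proof.
move=> dw; have -> : w = \sum_j (fun x => w x 0 j *: delta_mx 0 j).
  by apply/funext => y; rewrite fct_sumE -row_sum_delta.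
by apply: differentiable_sum => j; apply: differentiableZl.
Qed.

Lemma cvg_row (T : Type) (F : set_system T) (FF : Filter F) n
    (w : T -> 'rV[R]_n) (l : 'rV[R]_n) :
  (forall j, w x 0 j @[x --> F] --> l 0 j) -> w x @[x --> F] --> l.
Proof.
move=> cw; apply/cvgrPdist_le => /= e e0; near=> x.
rewrite /Num.Def.normr/= mx_normrE (bigmax_le _ (ltW e0))//= => i _.
rewrite !mxE/= ord1; move: (i.2); near: x; apply: filter_forall => j.
exact: ((cvgrPdist_le _ _).1 (cw j)).
Unshelve. all: by end_near. Qed.

Lemma is_derive_from_line (V : normedModType R) (f : V -> R) (x v : V) (d : R) :
  is_derive (0 : R) 1 (fun h => f (h *: v + x)) d -> is_derive x v f d.
Proof.
move=> [fd <-]; apply: DeriveDef; first exact/derivable1P.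
have E : (fun h : R => h^-1 *:
      (((fun h => f (h *: v + x)) \o shift 0) (h *: 1) - f (0 *: v + x))) =
    (fun h : R => h^-1 *: ((f \o shift x) (h *: v) - f x)).
  by apply/funext => h/=; rewrite addr0 scale0r add0r [h *: 1]mulr1.
by rewrite /derive E.
Qed.

(** Only derivatives of [w] along [v] are given, so the chain rule is applied on the line through
    [x], where derivability is differentiability. It serves for space and time derivatives alike. *)
Lemma is_derive_comp_row (V : normedModType R) n (B : 'rV[R]_n -> R)
    (w : V -> 'rV[R]_n) (x v : V) (dw : 'I_n -> R) :
  differentiable B (w x) ->
  (forall j, is_derive x v (fun x => w x 0 j) (dw j)) ->
  is_derive x v (fun x => B (w x)) (\sum_j dw j * partial j B (w x)).
Proof.
move=> dB dwx; apply: is_derive_from_line.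
pose phi (h : R) := w (h *: v + x).
have phi0 : phi 0 = w x by rewrite /phi scale0r add0r.
have dphij j : is_derive (0 : R) 1 (fun h => phi h 0 j) (dw j).
  by apply: (@is_derive_line _ _ (fun x => w x 0 j) x v 0);
    rewrite scale0r add0r.
have phid : derivable phi 0 1.
  by apply/derivable_mxP => i j; rewrite !ord1; exact: ex_derive.
have dphi : differentiable phi 0 by exact/derivable1_diffP.
have dB' : differentiable B (phi 0) by rewrite phi0.
have dc : differentiable (B \o phi) 0 by exact: differentiable_comp.
apply: DeriveDef; first exact/derivable1_diffP.
rewrite (@deriveE _ _ _ (B \o phi))// diff_comp//= -deriveE// -deriveE//.
rewrite derive_partial// phi0; apply: eq_bigr => j _; congr (_ * _).
by rewrite derive_mx// mxE; exact: derive_val.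
Qed.

Lemma is_derive_dotv m (a x v : 'rV[R]_m) : is_derive x v (dotv a) (dotv a v).
Proof.
apply: is_derive_from_line.
have -> : (fun h => dotv a (h *: v + x)) = id * cst (dotv a v) + cst (dotv a x).
  apply/funext => h; rewrite /dotv linearD linearZ/= mulmxDr -scalemxAr.
  by rewrite !mxE.
by apply: is_derive_eq; rewrite /GRing.scale/= addr0 mulr0 add0r mulr1.
Qed.

Lemma differentiable_dotv m (a x : 'rV[R]_m) : differentiable (dotv a) x.
Proof.
have -> : dotv a = \sum_i (a 0 i \*: (fun x : 'rV[R]_m => x 0 i)).
  apply/funext => y; rewrite fct_sumE /dotv mxE.
  by apply: eq_bigr => i _; rewrite mxE.
apply: differentiable_sum => i; apply: differentiableZ.
exact: differentiable_coord.
Qed.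

End Rows.

(** * The composite of [B] with the heat flows and its hill property *)

Section HeatComposite.
Context {R : realType}.
Variables (k n : nat) (Omega : set 'rV[R]_n) (B : 'rV[R]_n -> R).
Variables (A : 'M[R]_(k, n)) (C : 'M[R]_k) (u : 'I_n -> R -> R).
Hypothesis sB : smooth Omega B.
Hypothesis c_gt0 : forall j, 0 < quad C (acol A j).
Hypothesis cu : forall j, continuous (u j).
Hypothesis bu : forall j, exists M : R, forall z, `|u j z| <= M.

Let c j := quad C (acol A j).
Let ut (x : 'rV[R]_k) (t : R) : 'rV[R]_n :=
  \row_j heat_flow (c j) (u j) (dotv (acol A j) x) t.
Hypothesis Out : forall x (t : R), 0 <= t -> Omega (ut x t).
Let V x t := B (ut x t).

Let h1 j (x : 'rV[R]_k) t := heat_flow1 (u j) (c j) (dotv (acol A j) x) t.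
Let h2 j (x : 'rV[R]_k) t := heat_flow2 (u j) (c j) (dotv (acol A j) x) t.

Let dB w : Omega w -> differentiable B w.
Proof. exact: (sB [::]). Qed.

Let dpB j w : Omega w -> differentiable (partial j B) w.
Proof. exact: (sB [:: delta_mx 0 j]). Qed.

Let dotv_acol j i : dotv (acol A j) (delta_mx 0 i) = A i j.
Proof. by rewrite /dotv trmx_delta -colE !mxE. Qed.

Let is_derive_compdot (f f' : R -> R) j (x : 'rV[R]_k) i :
  (forall y : R, is_derive y 1 f (f' y)) ->
  is_derive x (delta_mx 0 i) (fun x => f (dotv (acol A j) x))
    (A i j * f' (dotv (acol A j) x)).
Proof.
move=> df; apply: is_derive_from_line.
have dl : is_derive (0 : R) 1
    (fun h => dotv (acol A j) (h *: delta_mx 0 i + x)) (A i j).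
  apply: is_derive_line; rewrite scale0r add0r -dotv_acol.
  exact: is_derive_dotv.
rewrite mulrC; apply: (@is_derive1_comp R f _ 0 _ _ _ dl).
by rewrite scale0r add0r.
Qed.

Let dut_space j (x : 'rV[R]_k) (t : R) i : 0 < t ->
  is_derive x (delta_mx 0 i) (fun x => ut x t 0 j) (A i j * h1 j x t).
Proof.
move=> t0; have [M uM] := bu j.
under eq_fun do rewrite mxE.
apply: (@is_derive_compdot (fun y => heat_flow (c j) (u j) y t)
  (fun y => heat_flow1 (u j) (c j) y t)) => y.
exact: (is_derive_heat_flow1 (@cu j) uM (c_gt0 j)).
Qed.

Let dh1_space j (x : 'rV[R]_k) (t : R) i : 0 < t ->
  is_derive x (delta_mx 0 i) (fun x => h1 j x t) (A i j * h2 j x t).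
Proof.
move=> t0; have [M uM] := bu j.
apply: (@is_derive_compdot (fun y => heat_flow1 (u j) (c j) y t)
  (fun y => heat_flow2 (u j) (c j) y t)) => y.
exact: (is_derive_heat_flow2 (@cu j) uM (c_gt0 j)).
Qed.

Let dut_time j (x : 'rV[R]_k) (t : R) : 0 < t ->
  is_derive t 1 (fun t => ut x t 0 j) (c j * h2 j x t).
Proof.
move=> t0; have [M uM] := bu j.
under eq_fun do rewrite mxE.
exact: (heat_equation (@cu j) uM (c_gt0 j)).
Qed.

Let diff_compdot (f f' : R -> R) j (x : 'rV[R]_k) :
  (forall y : R, is_derive y 1 f (f' y)) ->
  differentiable (fun x => f (dotv (acol A j) x)) x.
Proof.
move=> df; apply: (@differentiable_comp _ _ _ _ (dotv (acol A j)) f).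
  exact: differentiable_dotv.
by apply/derivable1_diffP; exact: ex_derive.
Qed.

Let diff_ut (x : 'rV[R]_k) (t : R) : 0 < t -> differentiable (ut ^~ t) x.
Proof.
move=> t0; apply: differentiable_row => j; have [M uM] := bu j.
under eq_fun do rewrite mxE.
apply: (@diff_compdot (fun y => heat_flow (c j) (u j) y t)
  (fun y => heat_flow1 (u j) (c j) y t)) => y.
exact: (is_derive_heat_flow1 (@cu j) uM (c_gt0 j)).
Qed.

Let diff_h1 j (x : 'rV[R]_k) (t : R) : 0 < t ->
  differentiable (fun x => h1 j x t) x.
Proof.
move=> t0; have [M uM] := bu j.
apply: (@diff_compdot (fun y => heat_flow1 (u j) (c j) y t)
  (fun y => heat_flow2 (u j) (c j) y t)) => y.
exact: (is_derive_heat_flow2 (@cu j) uM (c_gt0 j)).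
Qed.

Lemma composite_differentiable x (t : R) : 0 < t -> differentiable (V ^~ t) x.
Proof.
move=> t0; apply: (@differentiable_comp _ _ _ _ (ut ^~ t) B).
  exact: diff_ut.
by apply/dB/Out/ltW.
Qed.

Lemma composite_partial i (t : R) : 0 < t -> partial i (V ^~ t) =
  \sum_j (cst (A i j) * (fun x => h1 j x t) *
          (fun x => partial j B (ut x t))).
Proof.
move=> t0; apply/funext => x; rewrite fct_sumE.
have dv := is_derive_comp_row (w := ut^~ t) (dB (Out x (ltW t0)))
  (fun j => dut_space j x i t0).
by rewrite /partial; have [_ ->] := dv; apply: eq_bigr.
Qed.

Lemma composite_partial_differentiable i x (t : R) : 0 < t ->
  differentiable (partial i (V ^~ t)) x.
Proof.
move=> t0; rewrite composite_partial//; apply: differentiable_sum => j.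
apply: differentiableM; first by apply: differentiableM => //; exact: diff_h1.
apply: (@differentiable_comp _ _ _ _ (ut ^~ t) (partial j B)).
  exact: diff_ut.
by apply/dpB/Out/ltW.
Qed.

Lemma composite_partial2 i l x (t : R) : 0 < t ->
  partial i (partial l (V ^~ t)) x =
  \sum_j (A l j * h1 j x t * (\sum_m A i m * h1 m x t * hess B (ut x t) m j)
          + partial j B (ut x t) * (A l j * (A i j * h2 j x t))).
Proof.
move=> t0; rewrite composite_partial//.
have dj j : is_derive x (delta_mx 0 i)
   ((cst (A l j) * (fun x => h1 j x t)) * (fun x => partial j B (ut x t)))
   (A l j * h1 j x t * (\sum_m A i m * h1 m x t * hess B (ut x t) m j)
          + partial j B (ut x t) * (A l j * (A i j * h2 j x t))).
  have d1 := dh1_space j x i t0.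
  have d2 := is_derive_comp_row (w := ut^~ t) (dpB j (Out x (ltW t0)))
    (fun m => dut_space m x i t0).
  apply: is_derive_eq; rewrite /GRing.scale/= !fctE mulr0 addr0.
  congr (_ * _ + _); apply: eq_bigr => m _; by rewrite mxE.
by rewrite /partial; apply: derive_val.
Qed.

Lemma composite_derivative_time x (t : R) : 0 < t ->
  is_derive t 1 (V x) (\sum_j c j * h2 j x t * partial j B (ut x t)).
Proof.
move=> t0; apply: is_derive_comp_row; first exact/dB/Out/ltW.
by move=> j; exact: dut_time.
Qed.

Lemma composite_heat_operator x (t : R) : 0 < t ->
  opL C (V ^~ t) x - derive1 (V x) t =
  quad (schur (A^T *m C *m A) (hess B (ut x t))) (\row_j h1 j x t).
Proof.
move=> t0; rewrite derive1E.
have [_ ->] := composite_derivative_time x t0.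
set G := A^T *m C *m A; set H := hess B (ut x t).
(* The first summand is the quadratic form to be kept; the second is the time derivative, which
   cancels. *)
suff -> : opL C (V ^~ t) x =
    \sum_j (\sum_m G m j * H m j * (h1 m x t * h1 j x t) +
            c j * h2 j x t * partial j B (ut x t)).
  rewrite big_split/= addrK quadE exchange_big/=; apply: eq_bigr => m _.
  by apply: eq_bigr => j _; rewrite !mxE.
have GE m j : G m j = \sum_l (\sum_i A i m * C i l) * A l j.
  rewrite /G mxE; apply: eq_bigr => l _; rewrite mxE; congr (_ * _).
  by apply: eq_bigr => i _; rewrite mxE.
rewrite /opL.
under eq_bigr do under eq_bigr do rewrite composite_partial2// mulr_sumr.
under eq_bigr do rewrite exchange_big/=.
rewrite exchange_big/=; apply: eq_bigr => j _.
under eq_bigr do under eq_bigr do rewrite mulrDr.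
under eq_bigr do rewrite big_split/=.
(* In the terms with second derivatives of the flows, contracting [C] with the column [a_j] twice
   produces [c j]. The remaining terms assemble the entries of [A^T *m C *m A]. *)
rewrite big_split/=; congr (_ + _); last first.
  rewrite /c quadE !mulr_suml; apply: eq_bigr => i _.
  by rewrite !mulr_suml; apply: eq_bigr => l _; rewrite !mxE; ring.
under eq_bigr do under eq_bigr do rewrite !mulr_sumr.
under eq_bigr do rewrite exchange_big/=.
rewrite exchange_big/=; apply: eq_bigr => m _.
rewrite GE exchange_big/= !mulr_suml; apply: eq_bigr => l _.
rewrite !mulr_suml; apply: eq_bigr => i _; rewrite -/H.
by move: (H m j) (h1 m x t) (h1 j x t) => Hmj hm hj; ring.
Qed.

Lemma continuous_composite :
  {within [set p : 'rV[R]_k * R | 0 <= p.2], continuous (fun p => V p.1 p.2)}.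
Proof.
apply/subspace_continuousP => p p0; apply: cvg_within_filter.
have cB : {for ut p.1 p.2, continuous B}.
  exact/differentiable_continuous/dB/Out.
suff cut : ut q.1 q.2 @[q --> p] --> ut p.1 p.2.
  exact: (continuous_cvg _ cB cut).
apply: cvg_row => j.
under eq_fun do rewrite mxE.
rewrite mxE; have [M uM] := bu j.
have cd : dotv (acol A j) q.1 @[q --> p] --> dotv (acol A j) p.1.
  have cdot : {for p.1, continuous (dotv (acol A j))}.
    exact/differentiable_continuous/differentiable_dotv.
  have c1 : q.1 @[q --> p] --> p.1 by exact: cvg_fst.
  exact: (continuous_cvg _ cdot c1).
have cp : (dotv (acol A j) q.1, q.2) @[q --> p] --> (dotv (acol A j) p.1, p.2).
  have c2 : q.2 @[q --> p] --> p.2 by exact: cvg_snd.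
  exact: (cvg_pair cd c2).
have ch : {for (dotv (acol A j) p.1, p.2),
    continuous (fun q : R * R => heat_flow (c j) (u j) q.1 q.2)}.
  exact: continuous_heat_flow.
exact: (continuous_cvg _ ch cp).
Qed.

Lemma composite_hill :
  (forall w, Omega w ->
     let P := orthoproj (kerc (A *m diag_mx (grad B w))) in
     nsd (P *m schur (A^T *m C *m A) (hess B w) *m P)) ->
  hill C V.
Proof.
move=> curv x t t0 g0 _; rewrite composite_heat_operator//.
have /= := curv _ (Out x (ltW t0)) (\row_j h1 j x t).
rewrite quad_orthoproj//; apply/sub_kermxP.
(* The [i]-th entry of the product with the transpose of [A *m diag_mx (grad B w)] is the [i]-th
   partial derivative of [V]. *)
apply/rowP => i; have /rowP/(_ i) := g0.
rewrite [in X in X -> _]mxE composite_partial// fct_sumE => gi.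
rewrite trmx_mul tr_diag_mx mul_diag_mx.
rewrite -gi mxE; apply: eq_bigr => j _; rewrite !mxE !fctE.
by move: (partial j B _) (h1 j x t) => b h; ring.
Qed.

End HeatComposite.

Theorem theorem2 (R : realType) (k n : nat) (hk : (1 <= k)%N) (hkn : (k <= n)%N) :
  (forall (V : 'rV[R]_k -> R -> R) (C : 'M[R]_k),
     smooth_spacetime V -> C^T = C -> psd C -> hill C V -> liminf_nonneg V ->
     (forall x, 0 <= V x 0) -> forall x t, 0 <= t -> 0 <= V x t)
  /\
  (forall (Omega : set 'rV[R]_n) (B : 'rV[R]_n -> R)
          (A : 'M[R]_(k, n)) (C : 'M[R]_k) (u : 'I_n -> R -> R),
     domain Omega -> smooth Omega B ->
     \rank A = k ->
     C^T = C -> psd C -> (forall j, 0 < quad C (acol A j)) ->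
     (forall w, Omega w ->
        let P := orthoproj (kerc (A *m diag_mx (grad B w))) in
        nsd (P *m schur (A^T *m C *m A) (hess B w) *m P)) ->
     (forall j, smooth [set: R] (u j)) ->
     (forall j, bounded_fun (u j)) ->
     let ut (x : 'rV[R]_k) (t : R) : 'rV[R]_n :=
       \row_j heat_flow (quad C (acol A j)) (u j) (dotv (acol A j) x) t in
     (forall x t, 0 <= t -> Omega (ut x t)) ->
     let V x t := B (ut x t) in
     hill C V /\
     (liminf_nonneg V -> (forall x, 0 <= V x 0) ->
        (forall x t, 0 <= t -> 0 <= V x t) /\
        0 <= B (\row_j
          (\int[normal_prob 0 1]_(y in setT)
             u j (y * Num.sqrt (quad C (acol A j))))%R))).
Proof.
split.
  move=> V C sV symC pC hV lV V0.
  apply: (max_principle _ _ _ _ symC pC hV lV V0).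
  - exact: smooth_spacetime_continuous.
  - by move=> x t; exact: slice_differentiable.
  - by move=> x t j t0; exact: slice_partial_differentiable.
  - by move=> x t; exact: slice_derivable_time.
move=> Omega B A C u _ sB _ symC pC c_gt0 curv su bu ut Out V.
have cu j : continuous (u j).
  by move=> y; apply: differentiable_continuous; exact: (su j [::]).
have bu' j : exists M : R, forall z, `|u j z| <= M.
  have [M [_ bM]] := bu j.
  by exists (M + 1) => z; apply: bM => //; rewrite ltrDl.
have hV : hill C V by exact: (composite_hill sB c_gt0 cu bu' Out curv).
split=> // lV V0.
(* The maximum principle is applied directly and not through (i), since at [t = 0] only the
   continuity of [V] has been established. *)
have Vge0 : forall x t, 0 <= t -> 0 <= V x t.
  apply: (max_principle _ _ _ _ symC pC hV lV V0).
  - exact: (continuous_composite sB cu bu' Out).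
  - by move=> x t; exact: (composite_differentiable sB c_gt0 cu bu' Out).
  - move=> x t j.
    exact: (composite_partial_differentiable sB c_gt0 cu bu' Out).
  - move=> x t t0; have d := composite_derivative_time sB c_gt0 cu bu' Out x t0.
    exact: ex_derive.
split=> //.
(* At [x = 0] the base point of every flow is 0, and at [t = 1/2] the factor [2 * t] under the root
   is 1. *)
have := Vge0 0 2^-1; rewrite invr_ge0 ler0n => /(_ isT).
rewrite /V; congr (is_true (0 <= B _)); apply/rowP => j.
rewrite !mxE /heat_flow.
apply: eq_Rintegral => y _.
by rewrite /dotv trmx0 mulmx0 mxE add0r divff ?mul1r// pnatr_eq0.
Qed.
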